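(* Every tournament on $n$ vertices can be embedded in an invertible (and hence unimodular) tournament on $2n$ vertices; that is, for every tournament $T$ on $n$ vertices there is an invertible tournament on $2n$ vertices having a subtournament isomorphic to $T$.
   Context: The skew-adjacency matrix of a tournament with vertex set $\{v_1,\ldots,v_n\}$ is the $n\times n$ zero-diagonal matrix $S=[s_{ij}]$ in which $s_{ij}=1$ and $s_{ji}=-1$ if $v_i$ dominates $v_j$. A tournament is unimodular if the determinant of its skew-adjacency matrix is $1$. A unimodular tournament with skew-adjacency matrix $S$ is invertible if $S^{-1}$ is the skew-adjacency matrix of a tournament. A subtournament is the tournament induced on a subset of the vertices. *)

(* Defs.v *)
From mathcomp Require Import all_boot all_order all_algebra.

Set Implicit Arguments.
Unset Strict Implicit.
Unset Printing Implicit Defensive.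

Import GRing.Theory.
Local Open Scope ring_scope.

Record tournament (V : finType) := Tournament {
  dominates :> rel V;
  dominates_irr : irreflexive dominates;
  dominates_xor : forall x y : V, x != y -> dominates x y (+) dominates y x
}.

Section Subtournament.
Variables (V : finType) (T : tournament V) (A : {set V}).

Let sub_dominates : rel {x : V | x \in A} :=
  fun x y => dominates T (val x) (val y).

Lemma sub_dominates_irr : irreflexive sub_dominates.
Proof. by move=> x; apply: dominates_irr. Qed.

Lemma sub_dominates_xor x y :
  x != y -> sub_dominates x y (+) sub_dominates y x.
Proof. by move=> nxy; apply: dominates_xor; rewrite (inj_eq val_inj). Qed.

Definition subtournament : tournament {x : V | x \in A} :=
  Tournament sub_dominates_irr sub_dominates_xor.

End Subtournament.

Definition isomorphic (V W : finType) (T : tournament V) (U : tournament W) :=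
  exists2 f : V -> W, bijective f &
    forall x y : V, dominates U (f x) (f y) = dominates T x y.

Definition skew_adj (n : nat) (T : tournament 'I_n) : 'M[int]_n :=
  \matrix_(i, j) if dominates T i j then 1
                 else if dominates T j i then -1 else 0.

Definition unimodular (n : nat) (T : tournament 'I_n) : Prop :=
  \det (skew_adj T) = 1.

(* [invmx] returns its argument unchanged on matrices that are not invertible
   over [int]; unimodularity rules this case out, and then [invmx] is also the
   inverse over the rationals. *)
Definition invertible (n : nat) (T : tournament 'I_n) : Prop :=
  unimodular T /\
  exists T' : tournament 'I_n, invmx (skew_adj T) = skew_adj T'.

(* Main.v *)
Require Import Defs.
From mathcomp Require Import all_boot all_order all_algebra.
From mathcomp Require Import zify.

(** Replace every vertex of [T] by a dominating pair: if [S] is the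
    skew-adjacency matrix of [T], the resulting tournament on [2n] vertices has
    the matrix [[S, S + 1], [S - 1, S]], which is the product of unitriangular
    matrices [[1, 1], [0, 1]] [[1, 0], [S - 1, 1]] [[1, 1], [0, 1]].  So its
    determinant is 1, and inverting the factors gives
    [[S, - (S + 1)], [- (S - 1), S]], again the matrix of a tournament. *)

Set Implicit Arguments.
Unset Strict Implicit.
Unset Printing Implicit Defensive.

Import GRing.Theory Num.Theory.
Local Open Scope ring_scope.

(** Take the image of [f] as the vertex set: [f] corestricted to it is injective between finite
    types of equal cardinality, hence bijective. *)
Lemma isomorphic_subtournament (V W : finType) (T : tournament V)
    (U : tournament W) (f : V -> W) :
  injective f -> (forall x y, dominates U (f x) (f y) = dominates T x y) ->
  exists A : {set W}, isomorphic T (subtournament U A).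
Proof.
move=> f_inj f_dom; exists [set f x | x : V].
have f_im x : f x \in [set f z | z : V] by apply: imset_f.
exists (fun x => exist (fun y => y \in [set f z | z : V]) (f x) (f_im x)) => //.
apply: inj_card_bij => [x y [/f_inj]//|].
by rewrite card_sig card_imset // cardT.
Qed.

(** Intrinsic form of being a skew-adjacency matrix, as [tournament_mxP] shows; it can be checked
    block by block. *)
Definition tournament_mx (n : nat) (M : 'M[int]_n) : Prop :=
  M^T = - M /\ forall i j, `|M i j| = (i != j)%:R.

Lemma dominates_skew_adj (n : nat) (T : tournament 'I_n) i j :
  dominates T i j = (skew_adj T i j == 1).
Proof. by rewrite mxE; case: (dominates T i j) => //; case: (dominates T j i). Qed.

Lemma skew_adj_tournament_mx (n : nat) (T : tournament 'I_n) :
  tournament_mx (skew_adj T).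
Proof.
split=> [|i j]; last first.
  rewrite mxE; have [<-|/(dominates_xor T)] := eqVneq i j.
    by rewrite dominates_irr.
  by case: (dominates T i j); case: (dominates T j i).
apply/matrixP=> i j; rewrite !mxE; have [<-|/(dominates_xor T)] := eqVneq i j.
  by rewrite dominates_irr.
by case: (dominates T i j); case: (dominates T j i).
Qed.

Lemma tournament_mxP (n : nat) (M : 'M[int]_n) :
  tournament_mx M <-> exists T : tournament 'I_n, M = skew_adj T.
Proof.
split=> [[skewM absM]|[T ->]]; last exact: skew_adj_tournament_mx.
have skewE i j : M j i = - M i j by have /matrixP/(_ i j) := skewM; rewrite !mxE.
(* The tournament is read off from the entries equal to 1. Off the diagonal, [M i j] and [M j i] are
   opposite units, so exactly one of them is 1. *)
have M_irr : irreflexive (fun i j => M i j == 1).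
  by move=> i /=; have := absM i i; rewrite eqxx; lia.
have M_xor i j : i != j -> (M i j == 1) (+) (M j i == 1).
  by move=> nij; have := absM i j; rewrite skewE nij; lia.
exists (Tournament M_irr M_xor); apply/matrixP=> i j; rewrite mxE /= (skewE i j).
by have := absM i j; case: (i != j); do ![case: eqP]; lia.
Qed.

(** The block [E] records the arcs between two disjoint copies of the vertex set, so even its
    diagonal entries must be units. *)
Lemma tournament_mx_block (n : nat) (S E : 'M[int]_n) :
    tournament_mx S -> (forall i j, `|E i j| = 1) ->
  tournament_mx (block_mx S E (- E^T) S).
Proof.
move=> [skewS absS] absE; split.
  by rewrite tr_block_mx opp_block_mx skewS linearN /= trmxK opprK.
move=> i j; rewrite -[i]splitK -[j]splitK; case: (split i) (split j) => k [l|l] /=.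
- by rewrite block_mxEul absS (inj_eq (@lshift_inj _ _)).
- by rewrite block_mxEur absE eq_lrshift.
- by rewrite block_mxEdl !mxE normrN absE eq_rlshift.
- by rewrite block_mxEdr absS (inj_eq (@rshift_inj _ _)).
Qed.

Section Double.
Variables (n : nat) (S : 'M[int]_n).

Definition double_mx := block_mx S (S + 1%:M) (S - 1%:M) S.
Definition double_inv_mx := block_mx S (- (S + 1%:M)) (- (S - 1%:M)) S.

Lemma double_mx_factor :
  double_mx = block_mx 1%:M 1%:M 0 1%:M *m block_mx 1%:M 0 (S - 1%:M) 1%:M
              *m block_mx 1%:M 1%:M 0 1%:M.
Proof.
rewrite !mulmx_block !mul1mx !mul0mx !mulmx1 !mulmx0 !add0r !addr0.
by rewrite addrC subrK.
Qed.

Lemma double_inv_mx_factor :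
  double_inv_mx =
    block_mx 1%:M (- 1%:M) 0 1%:M *m block_mx 1%:M 0 (- (S - 1%:M)) 1%:M
    *m block_mx 1%:M (- 1%:M) 0 1%:M.
Proof.
rewrite !mulmx_block !mul1mx !mul0mx !mulmx1 !mulmx0 !add0r !addr0.
by rewrite !mulNmx !mulmxN !mul1mx !mulmx1 !opprK (addrC 1%:M) subrK -opprD.
Qed.

Lemma det_double_mx : \det double_mx = 1.
Proof. by rewrite double_mx_factor !det_mulmx !det_ublock det_lblock !det1 !mulr1. Qed.

Lemma mul_double_mx : double_mx *m double_inv_mx = 1%:M.
Proof.
have uU (A : 'M[int]_n) :
    block_mx 1%:M A 0 1%:M *m block_mx 1%:M (- A) 0 1%:M = 1%:M.
  rewrite mulmx_block !mul1mx !mul0mx !mulmx1 !mulmx0 !add0r !addr0.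
  by rewrite addNr -scalar_mx_block.
have lL (A : 'M[int]_n) :
    block_mx 1%:M 0 A 1%:M *m block_mx 1%:M 0 (- A) 1%:M = 1%:M.
  rewrite mulmx_block !mul1mx !mul0mx !mulmx1 !mulmx0 !add0r !addr0.
  by rewrite subrr -scalar_mx_block.
(* Both factorizations are palindromic, so the six factors cancel in pairs from the middle
   outwards. *)
rewrite double_mx_factor double_inv_mx_factor -!mulmxA.
by rewrite [X in _ *m (_ *m X)]mulmxA uU mul1mx [X in _ *m X]mulmxA lL mul1mx uU.
Qed.

Lemma invmx_double_mx : invmx double_mx = double_inv_mx.
Proof.
have [unitM _] := mulmx1_unit mul_double_mx.
by rewrite -[LHS]mulmx1 -mul_double_mx mulKmx.
Qed.

Hypothesis tournamentS : tournament_mx S.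

(** The identity fills exactly the zero diagonal of [S]. *)
Let abs_entry i j : `|(S + 1%:M) i j| = 1.
Proof.
have [_ /(_ i j)] := tournamentS; rewrite !mxE.
by case: eqP => _ /=; lia.
Qed.

Let tr_entry : (S + 1%:M)^T = - (S - 1%:M).
Proof.
by have [skewS _] := tournamentS; rewrite linearD /= skewS trmx1 opprB addrC.
Qed.

Lemma tournament_double_mx : tournament_mx double_mx.
Proof.
rewrite /double_mx -[S - _]opprK -tr_entry.
exact: tournament_mx_block tournamentS abs_entry.
Qed.

Lemma tournament_double_inv_mx : tournament_mx double_inv_mx.
Proof.
have absN i j : `|(- (S + 1%:M)) i j| = 1 by rewrite mxE normrN abs_entry.
(* With [E = - (S + 1)], the lower left block [- E^T] is [(S + 1)^T = - (S - 1)]. *)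
by have := tournament_mx_block tournamentS absN; rewrite linearN /= tr_entry opprK.
Qed.

End Double.

Local Close Scope ring_scope.

Theorem mainTheorem3 (n : nat) (T : tournament 'I_n) :
  exists U : tournament 'I_(2 * n),
    invertible U /\
    exists A : {set 'I_(2 * n)}, isomorphic T (subtournament U A).
Proof.
have -> : (2 * n = n + n)%N by rewrite mul2n addnn.
have tS := skew_adj_tournament_mx T.
have [U defU] := (tournament_mxP _).1 (tournament_double_mx tS).
have [U' defU'] := (tournament_mxP _).1 (tournament_double_inv_mx tS).
exists U; split.
  split; first by rewrite /unimodular -defU det_double_mx.
  by exists U'; rewrite -defU invmx_double_mx.
(* The first copy of the vertices carries the upper left block [S], hence [T] itself. *)
apply: (isomorphic_subtournament (f := @lshift n n)) => [|i j].
  exact: lshift_inj.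
by rewrite !dominates_skew_adj -defU block_mxEul.
Qed.
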